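(* Let $N\ge 2$, $p\ge 2$, let $\Omega\subset\mathbb{R}^N$ be a radially symmetric domain and let $V\in C(\Omega)$ with $V\ge 0$ in $\Omega$. Let $u,v$ be radial functions of class $C^2$ in $\Omega$ such that $$0<v\le u\quad\text{in }\Omega$$ and $$u'\le v'<0\ \text{ in }\Omega\qquad\text{or}\qquad u'\ge v'>0\ \text{ in }\Omega .$$ If $u$ is a subsolution and $v$ is a supersolution of the equation $-\Delta_p w-V|w|^{p-2}w=0$ in $\Omega$, then $u-v$ is a subsolution of this equation in $\Omega$.
   Context: Here $\Delta_p w=\nabla\cdot(|\nabla w|^{p-2}\nabla w)$ is the $p$-Laplacian. Sub- and supersolutions are understood in the classical sense: a $C^2$ function $w$ on $\Omega$ is a subsolution (resp. supersolution) if $-\Delta_p w-V|w|^{p-2}w\le 0$ (resp. $\ge 0$) pointwise in $\Omega$. A radial function $w(x)=\phi(|x|)$ is identified with $\phi$, and $w'$ denotes $\phi'(r)$, the derivative with respect to $r=|x|$. A domain is a connected open set. *)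

(* Defs.v *)
From HB Require Import structures.
From mathcomp Require Import all_boot all_order all_algebra.
From mathcomp Require Import all_classical all_reals all_analysis.
Set Implicit Arguments. Unset Strict Implicit. Unset Printing Implicit Defensive.
Import Order.TTheory GRing.Theory Num.Theory.
Import numFieldNormedType.Exports.
Local Open Scope classical_set_scope.
Local Open Scope ring_scope.

Section Plap.
Variables (R : realType) (N : nat).
Notation V := 'rV[R]_N.

(* Euclidean norm |x| (the library norm on 'rV is the sup norm). *)
Definition enorm (x : V) : R := Num.sqrt (\sum_(i < N) x ord0 i ^+ 2).

Definition ebase (i : 'I_N) : V := delta_mx ord0 i.

Definition pderiv (i : 'I_N) (w : V -> R) (y : V) : R := 'D_(ebase i) w y.

Definition grad (w : V -> R) (y : V) : V := \row_i pderiv i w y.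

Definition pflux (p : R) (w : V -> R) (i : 'I_N) (y : V) : R :=
  (enorm (grad w y)) `^ (p - 2) * pderiv i w y.

Definition plap (p : R) (w : V -> R) (x : V) : R :=
  \sum_(i < N) pderiv i (pflux p w i) x.

Definition C2_on (Omega : set V) (w : V -> R) : Prop :=
  forall x, Omega x ->
    [/\ {for x, continuous w},
        forall i, derivable w x (ebase i) /\ {for x, continuous (pderiv i w)}
      & forall i j, derivable (pderiv i w) x (ebase j) /\
                    {for x, continuous (pderiv j (pderiv i w))}].

Definition plap_exists (p : R) (w : V -> R) (x : V) : Prop :=
  forall i, derivable (pflux p w i) x (ebase i).

Definition Lop (p : R) (Vpot : V -> R) (w : V -> R) (x : V) : R :=
  - plap p w x - Vpot x * (`|w x| `^ (p - 2) * w x).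

Definition subsolution (p : R) (Vpot : V -> R) (Omega : set V) (w : V -> R) :=
  C2_on Omega w /\
  forall x, Omega x -> plap_exists p w x /\ Lop p Vpot w x <= 0.

Definition supersolution (p : R) (Vpot : V -> R) (Omega : set V) (w : V -> R) :=
  C2_on Omega w /\
  forall x, Omega x -> plap_exists p w x /\ 0 <= Lop p Vpot w x.

Definition radial_domain (Omega : set V) : Prop :=
  open Omega /\ connected Omega /\ Omega !=set0 /\
  forall x y, enorm x = enorm y -> Omega x -> Omega y.

Definition radial_on (Omega : set V) (w : V -> R) : Prop :=
  exists phi : R -> R, forall x, Omega x -> w x = phi (enorm x).

(* radial derivative w'(x) = phi'(|x|): directional derivative along x/|x|
   (equals 0 at x = 0). *)
Definition rderiv (w : V -> R) (x : V) : R := 'D_((enorm x)^-1 *: x) w x.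

End Plap.

(* Main.v *)
Require Import Defs.
From HB Require Import structures.
From mathcomp Require Import all_boot all_order all_algebra.
From mathcomp Require Import all_classical all_reals all_analysis.
From mathcomp Require Import ring lra.
Set Implicit Arguments. Unset Strict Implicit. Unset Printing Implicit Defensive.
Import Order.TTheory GRing.Theory Num.Theory.
Import numFieldNormedType.Exports.
Local Open Scope classical_set_scope.
Local Open Scope ring_scope.

(** Write [n = x / |x|].  A radial [w] has gradient [w' n], so that
    [Delta_p w = |w'|^(p-2) M w] with
    [M w = Delta w + (p-2) <D^2 w n, n>], which is linear in [w]; this also
    holds where [w' = 0].  The origin is not in the domain, since the radial
    derivative vanishes there.  Solving the two differential inequalities for
    [M u] and [M v] and subtracting, the claim reduces to
    [u^(p-1)/|u'|^(p-2) <= v^(p-1)/|v'|^(p-2) + (u-v)^(p-1)/|u'-v'|^(p-2)].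
    As [|u'| = |v'| + |u'-v'|], this is the subadditivity of the perspective
    [(s, t) |-> s^(p-1) / t^(p-2)] of the convex power [s^(p-1)]. *)

(** * Directional derivatives by restriction to lines *)

Section Directional.
Variables (R : realType) (V : normedModType R).
Implicit Types (f g : V -> R) (x v : V).

Lemma is_derive_lineP f x v d :
  is_derive x v f d <-> is_derive (0 : R) 1 (fun t : R => f (t *: v + x)) d.
Proof.
have E : 'D_v f x = 'D_1 (fun t : R => f (t *: v + x)) 0.
  rewrite /derive; set g1 := fun h => h^-1 *: _; set g2 := fun h => h^-1 *: _.
  suff -> : g1 = g2 by [].
  by apply/funext => h; rewrite /g1 /g2 /= addr0 scale0r add0r [_%:A]mulr1.
split=> -[df <-].
  by apply: (DeriveDef _ (esym E)); apply: (iffLR (derivable1P f x v)).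
by apply: (DeriveDef _ E); apply: (iffRL (derivable1P f x v)).
Qed.

Lemma is_derive_comp (h : R -> R) f x v a b :
  is_derive (f x) 1 h a -> is_derive x v f b -> is_derive x v (h \o f) (a * b).
Proof.
move=> dh /is_derive_lineP df; apply/is_derive_lineP.
apply: (is_derive1_comp (f := h) (g := fun t => f (t *: v + x))).
by rewrite scale0r add0r.
Qed.

Lemma derivable_cvg_line f x v :
  derivable f x v -> f (t *: v + x) @[t --> (0 : R)] --> f x.
Proof.
move=> /derivable1P/derivable1_diffP/differentiable_continuous.
by rewrite /prop_for /continuous_at scale0r add0r.
Qed.

(** As [g x = 0], the difference quotient of [f * g] is that of [g] times [f] on the line, so
    continuity of [f] along the line suffices. This serves at critical points, where |grad w|^(p-2)
    may fail to be differentiable. *)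
Lemma is_deriveM0 f g x v d :
    f (t *: v + x) @[t --> (0 : R)] --> f x -> g x = 0 -> is_derive x v g d ->
  is_derive x v (f * g) (f x * d).
Proof.
move=> cf g0 [dg dgE].
have cvfg : h^-1 *: (((f * g) \o shift x) (h *: v) - (f * g) x)
    @[h --> (0 : R)^'] --> f x * d.
  have -> : (fun h : R => h^-1 *: (((f * g) \o shift x) (h *: v) - (f * g) x)) =
      (fun h => f (h *: v + x) * (h^-1 *: ((g \o shift x) (h *: v) - g x))).
    apply/funext => h /=; rewrite !mulrfctE /= g0 mulr0 !subr0 /GRing.scale /=.
    by rewrite mulrCA.
  by apply: cvgM; [exact: cvg_within_filter | rewrite -dgE].
apply: DeriveDef; first by apply/cvg_ex; eexists; exact: cvfg.
exact: cvg_lim cvfg.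
Qed.

End Directional.

(** * Real powers: limit at zero and convexity *)

Lemma cvg_powR_norm0 (R : realType) (q : R) :
  0 < q -> `|s| `^ q @[s --> (0 : R)] --> (0 : R).
Proof.
move=> q0; apply/cvgrPdist_lt => e e0.
have d0 : 0 < e `^ q^-1 by rewrite powR_gt0.
near=> s.
rewrite sub0r normrN ger0_norm ?powR_ge0//.
have -> : e = (e `^ q^-1) `^ q by rewrite -powRrM mulVf ?gt_eqF// powRr1// ltW.
apply: gt0_ltr_powR; rewrite ?nnegrE// ?powR_ge0//.
Unshelve. all: by end_near. Qed.

(* Convexity of the perspective [(s, t) |-> t * (s / t) ^ q]. *)
Lemma powR_perspective_subadditive (R : realType) (q s t b c : R) :
  1 <= q -> 0 <= s -> 0 <= t -> 0 < b -> 0 < c ->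
  (b + c) * ((s + t) / (b + c)) `^ q <= b * (s / b) `^ q + c * (t / c) `^ q.
Proof.
move=> q1 s0 t0 b0 c0; have bc0 : 0 < b + c by rewrite addr_gt0.
have k0 : 0 <= b / (b + c) by exact: divr_ge0 (ltW b0) (ltW bc0).
have k1 : b / (b + c) <= 1 by rewrite ler_pdivrMr// mul1r lerDl ltW.
(* With weights [b / (b + c)] and [c / (b + c)], the mean of [s / b] and [t / c] is
   [(s + t) / (b + c)]. *)
have := @convex_powR R q q1 (Itv01 k0 k1) (s / b) (t / c).
rewrite !inE/= !in_itv/= !andbT => /(_ (divr_ge0 s0 (ltW b0)) (divr_ge0 t0 (ltW c0))).
rewrite convRE [X in X `^ _ <= _]convRE/= /unstable.onem.
have -> : 1 - b / (b + c) = c / (b + c) by field; rewrite gt_eqF.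
have -> : b / (b + c) * (s / b) + c / (b + c) * (t / c) = (s + t) / (b + c).
  by field; rewrite !gt_eqF.
move=> H; rewrite -ler_pdivlMl//; apply: (le_trans H).
by rewrite mulrDr !mulrA ![(b + c)^-1 * _]mulrC.
Qed.

(** * Derivatives of sums of squares and their roots *)

Lemma is_derive_sumsq (R : realType) (V : normedModType R) (n : nat)
    (f : 'I_n -> V -> R) (d : 'I_n -> R) (x v : V) :
    (forall j, is_derive x v (f j) (d j)) ->
  is_derive x v (fun y => \sum_(j < n) f j y ^+ 2)
    (\sum_(j < n) 2 * (f j x * d j)).
Proof.
move=> df; have -> : (fun y => \sum_(j < n) f j y ^+ 2) = \sum_(j < n) (f j ^+ 2).
  by rewrite fct_sumE; apply/funext => y; apply: eq_bigr.
apply: is_derive_sum => j; apply: is_derive_eq (is_deriveX 2 (df j)) _.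
by rewrite /= expr1 /GRing.scale/= mulrA.
Qed.

(** Serves both |x| and |grad w|, away from their zeros. *)
Lemma is_derive_sqrt_sumsq (R : realType) (V : normedModType R) (n : nat)
    (f : 'I_n -> V -> R) (d : 'I_n -> R) (x v : V) :
    (forall j, is_derive x v (f j) (d j)) ->
    0 < Num.sqrt (\sum_(j < n) f j x ^+ 2) ->
  is_derive x v (fun y => Num.sqrt (\sum_(j < n) f j y ^+ 2))
    ((\sum_(j < n) f j x * d j) / Num.sqrt (\sum_(j < n) f j x ^+ 2)).
Proof.
move=> df s0.
have S0 : 0 < \sum_(j < n) f j x ^+ 2 by rewrite -sqrtr_gt0.
apply: is_derive_eq (is_derive_comp (is_derive1_sqrt S0) (is_derive_sumsq df)) _.
by rewrite -mulr_sumr; field; rewrite gt_eqF.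
Qed.

(** * The Euclidean norm *)

Section EuclideanNorm.
Variables (R : realType) (N : nat).
Implicit Types x v : 'rV[R]_N.

Lemma enorm_ge0 x : 0 <= enorm x.
Proof. exact: sqrtr_ge0. Qed.

Lemma sqr_enorm x : enorm x ^+ 2 = \sum_(i < N) x ord0 i ^+ 2.
Proof. by rewrite sqr_sqrtr// sumr_ge0// => i _; exact: sqr_ge0. Qed.

Lemma enorm_gt0_coord x : 0 < enorm x -> exists i, x ord0 i != 0.
Proof.
move=> x0; apply: contrapT => /forallNP h.
have : enorm x ^+ 2 = 0.
  rewrite sqr_enorm big1// => i _.
  by have /negP/negPn/eqP -> := h i; rewrite expr0n.
by apply/eqP; rewrite gt_eqF// exprn_gt0.
Qed.

Lemma enormZ (c : R) x : enorm (c *: x) = `|c| * enorm x.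
Proof.
rewrite /enorm -sqrtr_sqr -sqrtrM ?sqr_ge0// mulr_sumr.
by congr Num.sqrt; apply: eq_bigr => i _; rewrite mxE exprMn.
Qed.

Lemma is_derive_coord i x v :
  is_derive x v (fun y : 'rV[R]_N => y ord0 i) (v ord0 i).
Proof.
apply/is_derive_lineP.
have -> : (fun t : R => (t *: v + x) ord0 i) = v ord0 i \*: id + cst (x ord0 i).
  by apply/funext => t; rewrite !mxE /= mulrC.
apply: is_derive_eq; by rewrite addr0 [_ *: _]mulr1.
Qed.

Lemma is_derive_enorm x v : 0 < enorm x ->
  is_derive x v (@enorm R N) ((\sum_(i < N) x ord0 i * v ord0 i) / enorm x).
Proof.
by move=> x0; apply: is_derive_sqrt_sumsq => // i; exact: is_derive_coord.
Qed.

End EuclideanNorm.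

(** * Profile and gradient of a radial function *)

Section Radial.
Variables (R : realType) (N : nat).
Implicit Types (x v : 'rV[R]_N) (w : 'rV[R]_N -> R) (Omega : set 'rV[R]_N).

(* Moving along a coordinate direction transversal to the sphere through [x]
   parametrises the radius, so one partial derivative of [w] yields the
   derivative of the profile [phi]. *)
Lemma radial_profile_derive Omega w (phi : R -> R) x i :
    open Omega -> Omega x -> (forall y, Omega y -> w y = phi (enorm y)) ->
    0 < enorm x -> x ord0 i != 0 -> derivable w x (ebase R i) ->
  is_derive (enorm x) 1 phi (pderiv i w x * (enorm x / x ord0 i)).
Proof.
move=> oO Ox wphi; set r := enorm x; set a := x ord0 i => r0 a0 dw.
(* [g s] solves |x + t e_i| = s for t: the equation reads (a + t)^2 = a^2 + s^2 - r^2 = a^2 F(s),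
   and [a * Num.sqrt (F s)] is the root with the sign of [a], so that [g r = 0]. *)
pose F (s : R) : R := 1 + (s ^+ 2 - r ^+ 2) / a ^+ 2.
pose g (s : R) : R := a * Num.sqrt (F s) - a.
have Fr : F r = 1 by rewrite /F subrr mul0r addr0.
have gr : g r = 0 by rewrite /g Fr sqrtr1 mulr1 subrr.
have dF : is_derive r 1 F (2 * r / a ^+ 2).
  have -> : F = cst 1 + (a ^+ 2)^-1 \*: ((id : R -> R) ^+ 2 - cst (r ^+ 2)).
    by apply/funext => s; rewrite /F /= mulrC.
  apply: is_derive_eq.
  by rewrite /= /GRing.scale/= expr1 mulr1 subr0 add0r mulrC.
have dg : is_derive r 1 g (r / a).
  have dsF : is_derive r 1 (Num.sqrt \o F) ((2 * Num.sqrt (F r))^-1 * (2 * r / a ^+ 2)).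
    by apply: is_derive_comp dF; apply: is_derive1_sqrt; rewrite Fr.
  have -> : g = a \*: (Num.sqrt \o F) - cst a by [].
  apply: is_derive_eq; rewrite Fr sqrtr1 subr0 /GRing.scale/=.
  by field.
have cF : {for r, continuous F}.
  by apply/differentiable_continuous/derivable1_diffP; case: dF.
have cg : {for r, continuous g}.
  by apply/differentiable_continuous/derivable1_diffP; case: dg.
have Og : \forall s \near r, Omega (g s *: ebase R i + x).
  have : g s *: ebase R i + x @[s --> r] --> g r *: ebase R i + x.
    by apply: cvgD; [apply: cvgZr_tmp | exact: cvg_cst].
  by apply; rewrite gr scale0r add0r; exact: open_nbhs_nbhs.
have eng : \forall s \near r, enorm (g s *: ebase R i + x) = s.
  near=> s.
  have s0 : 0 < s by near: s; exact: lt_nbhsr.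
  have F0 : 0 < F s.
    by near: s; apply: (cvgr_gt (F r)) => //; rewrite Fr.
  rewrite -[RHS]gtr0_norm// -sqrtr_sqr; congr Num.sqrt.
  have := sqr_enorm x; rewrite -/r (bigD1 i)//= => rE.
  rewrite (bigD1 i)//= !mxE !eqxx/= mulr1.
  under eq_bigr => j ji do rewrite !mxE eqxx/= (negbTE ji) mulr0 add0r.
  rewrite /g subrK exprMn sqr_sqrtr ?ltW//.
  have -> : \sum_(j < N | j != i) x ord0 j ^+ 2 = r ^+ 2 - a ^+ 2.
    by rewrite rE -/a addrAC subrr add0r.
  by rewrite /F; field.
apply: (@near_eq_is_derive _ _ _ (fun s => w (g s *: ebase R i + x))).
  near=> s; rewrite wphi; last by near: s.
  by congr phi; near: s.
have dline : is_derive (g r) 1 (fun t : R => w (t *: ebase R i + x)) (pderiv i w x).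
  by rewrite gr; apply: (iffLR (is_derive_lineP w x _ _)); split.
exact: (is_derive1_comp dline dg).
Unshelve. all: by end_near. Qed.

(** Near [x], [w] is the profile composed with the norm, so the chain rule gives its derivative
    along v as phi'(|x|) <x, v> / |x|. Taking v = x / |x| identifies phi'(|x|) with [rderiv w x]. *)
Lemma radial_grad Omega w x :
    open Omega -> Omega x -> radial_on Omega w -> 0 < enorm x ->
    (forall i, derivable w x (ebase R i)) ->
  forall i, pderiv i w x = rderiv w x * (x ord0 i / enorm x).
Proof.
move=> oO Ox [phi wphi] x0 dw.
have [k xk0] := enorm_gt0_coord x0.
have := radial_profile_derive oO Ox wphi x0 xk0 (dw k).
set c := (X in is_derive _ _ _ X) => dphi.
have dv v : 'D_v w x = c * ((\sum_(i < N) x ord0 i * v ord0 i) / enorm x).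
  apply: derive_val; apply: (@near_eq_is_derive _ _ _ (phi \o @enorm R N)).
    have : nbhs x Omega by exact: open_nbhs_nbhs.
    by apply: filterS => y Oy; rewrite /= wphi.
  exact: is_derive_comp dphi (is_derive_enorm _ x0).
have rc : rderiv w x = c.
  rewrite /rderiv dv.
  under eq_bigr do rewrite mxE mulrCA -expr2.
  rewrite -mulr_sumr -sqr_enorm; field; exact: lt0r_neq0.
move=> i; rewrite rc /pderiv dv (bigD1 i)//= big1 => [|j ji].
  by rewrite !mxE !eqxx mulr1 addr0.
by rewrite !mxE eqxx/= (negbTE ji) mulr0.
Qed.

End Radial.

(** * The p-Laplacian of a function with radial gradient at a point *)

Section Flux.
Variables (R : realType) (N : nat) (p : R).
Implicit Types (x : 'rV[R]_N) (w : 'rV[R]_N -> R).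

(* [Delta w + (p - 2) <D^2 w n, n>] with [n = x / |x|]. *)
Definition radial_operator w x : R :=
  \sum_(i < N) (pderiv i (pderiv i w) x +
    (p - 2) * (x ord0 i / enorm x) *
      \sum_(j < N) x ord0 j / enorm x * pderiv i (pderiv j w) x).

Lemma enorm_gradE w x :
  enorm (grad w x) = Num.sqrt (\sum_(j < N) pderiv j w x ^+ 2).
Proof. by congr Num.sqrt; apply: eq_bigr => j _; rewrite mxE. Qed.

Lemma enorm_radial_grad w x (c : R) : 0 < enorm x ->
    (forall j, pderiv j w x = c * (x ord0 j / enorm x)) ->
  enorm (grad w x) = `|c|.
Proof.
move=> x0 gw; have -> : grad w x = (c / enorm x) *: x.
  by apply/rowP => j; rewrite !mxE gw mulrAC mulrA.
by rewrite enormZ normrM normfV (gtr0_norm x0) mulfVK// gt_eqF.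
Qed.

Lemma is_derive_pflux w x (c : R) i : 2 <= p -> 0 < enorm x ->
    (forall j, pderiv j w x = c * (x ord0 j / enorm x)) ->
    (forall j, derivable (pderiv j w) x (ebase R i)) ->
  is_derive x (ebase R i) (pflux p w i)
    (`|c| `^ (p - 2) * (pderiv i (pderiv i w) x +
      (p - 2) * (x ord0 i / enorm x) *
        \sum_(j < N) x ord0 j / enorm x * pderiv i (pderiv j w) x)).
Proof.
move=> p2 x0 gw dw; have ngw := enorm_radial_grad x0 gw.
have pfluxE : pflux p w i = (fun y => enorm (grad w y) `^ (p - 2)) * pderiv i w by [].
have dpw j : is_derive x (ebase R i) (pderiv j w) (pderiv i (pderiv j w) x) by [].
rewrite pfluxE; have [c0|c0] := eqVneq c 0.
  (* At a critical point only continuity of the factor |grad w|^(p-2) is available. For [p = 2] it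
     is constantly 1, since [powR] sets 0^0 = 1. *)
  have cw : enorm (grad w (t *: ebase R i + x)) `^ (p - 2) @[t --> (0 : R)]
      --> enorm (grad w x) `^ (p - 2).
    rewrite ngw c0 normr0; have [->|p2'] := eqVneq p 2.
      by rewrite subrr powRr0; under eq_fun do rewrite powRr0; exact: cvg_cst.
    have q0 : 0 < p - 2 by rewrite subr_gt0 lt_neqAle eq_sym p2'.
    rewrite powR0 ?gt_eqF//.
    have cn : enorm (grad w (t *: ebase R i + x)) @[t --> (0 : R)] --> (0 : R).
      have [/derivable_cvg_line cs _] := is_derive_sumsq dpw.
      have gE : (fun t : R => enorm (grad w (t *: ebase R i + x))) =
          Num.sqrt \o (fun t => \sum_(j < N) pderiv j w (t *: ebase R i + x) ^+ 2).
        by apply/funext => t; exact: enorm_gradE.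
      have := continuous_cvg (nbhs_filter (0 : R)) (@sqrt_continuous R _) cs.
      by rewrite -gE -enorm_gradE ngw c0 normr0.
    under eq_fun do rewrite -[enorm _]ger0_norm ?enorm_ge0//.
    exact: cvg_comp cn (cvg_powR_norm0 q0).
  have gi0 : pderiv i w x = 0 by rewrite gw c0 mul0r.
  apply: is_derive_eq (is_deriveM0 cw gi0 (dpw i)) _.
  (* For [p = 2] the coefficient [p - 2] removes the extra term; for p > 2 both sides vanish. *)
  rewrite ngw c0 normr0; have [->|p2'] := eqVneq p 2.
    by rewrite subrr !mul0r addr0.
  by rewrite powR0 ?mul0r// subr_eq0.
have nc0 : 0 < `|c| by rewrite normr_gt0.
have dn : is_derive x (ebase R i) (fun y => enorm (grad w y))
    ((\sum_(j < N) pderiv j w x * pderiv i (pderiv j w) x) / `|c|).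
  rewrite -ngw enorm_gradE; under eq_fun do rewrite enorm_gradE.
  by apply: is_derive_sqrt_sumsq => //; rewrite -enorm_gradE ngw.
have dpow := @is_derive1_powR R (p - 2) `|c| nc0.
rewrite -{1}ngw in dpow.
have dcomp := is_derive_comp (f := fun y => enorm (grad w y)) dpow dn.
apply: is_derive_eq (is_deriveM dcomp (dpw i)) _.
rewrite /= ngw gw (@powRB _ _ (p - 2) 1); last by rewrite normr_eq0 c0 implybT.
rewrite powRr1 ?normr_ge0// /GRing.scale/=.
under eq_bigr do rewrite gw -mulrA.
rewrite -mulr_sumr; set S := \sum_(j < N) _.
have cc : c * c = `|c| * `|c| by rewrite -!expr2 real_normK ?num_real.
have c0' : `|c| != 0 by rewrite gt_eqF.
rewrite mulrDr; congr (_ + _).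
set P := _ `^ _.
(* One factor [c] comes from the i-th partial derivative, the other from differentiating |grad w|;
   their product cancels |c|^2, whatever the sign of [c]. *)
have -> : c * (x ord0 i / enorm x) * ((p - 2) * (P / `|c|) * (c * S / `|c|)) =
    (c * c) / (`|c| * `|c|) * (P * ((p - 2) * (x ord0 i / enorm x) * S)).
  by field; rewrite c0' gt_eqF.
by rewrite cc divff ?mul1r// mulf_neq0.
Qed.

Lemma plap_radial w x (c : R) : 2 <= p -> 0 < enorm x ->
    (forall j, pderiv j w x = c * (x ord0 j / enorm x)) ->
    (forall i j, derivable (pderiv j w) x (ebase R i)) ->
  plap_exists p w x /\ plap p w x = `|c| `^ (p - 2) * radial_operator w x.
Proof.
move=> p2 x0 gw dw.
have dflux i := is_derive_pflux p2 x0 gw (dw i).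
split=> [i|]; first by case: (dflux i).
by rewrite /plap mulr_sumr; apply: eq_bigr => i _; apply: derive_val.
Qed.

End Flux.

(** * The pointwise inequality between real numbers *)

Lemma powR_quotient_subadditive (R : realType) (p u v a b : R) :
  2 <= p -> 0 <= v -> v <= u -> 0 < b -> b < a ->
  u `^ (p - 2) * u / a `^ (p - 2) <= v `^ (p - 2) * v / b `^ (p - 2) +
    (u - v) `^ (p - 2) * (u - v) / (a - b) `^ (p - 2).
Proof.
move=> p2 v0 vu b0 ba.
have q1 : 1 <= p - 1 by lra.
have E s t : 0 <= s -> 0 < t ->
    t * (s / t) `^ (p - 1) = s `^ (p - 2) * s / t `^ (p - 2).
  move=> s0 t0; have st0 : 0 <= s / t by rewrite divr_ge0// ltW.
  have P0 : t `^ (p - 2) != 0 by rewrite gt_eqF// powR_gt0.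
  rewrite -(mulr_powRB1 st0); last by lra.
  have -> : p - 1 - 1 = p - 2 by ring.
  have -> : s `^ (p - 2) = (s / t) `^ (p - 2) * t `^ (p - 2).
    by rewrite -powRM ?divfK ?gt_eqF// ltW.
  by field; rewrite P0 gt_eqF.
have u0 : 0 <= u by exact: le_trans vu.
(* The numerators [v] and [u - v] add up to [u], the denominators [b] and [a - b] to [a]. *)
have := @powR_perspective_subadditive R (p - 1) v (u - v) b (a - b) q1 v0.
rewrite subr_ge0 subr_gt0 => /(_ vu b0 ba).
by rewrite ![_ + (_ - _)]addrC !subrK !E ?subr_ge0 ?subr_gt0// (lt_trans b0).
Qed.

(** Here [A], [B] stand for the radial operators of the two functions and [a], [b] for |u'|, |v'|.
    In the main case, dividing by the positive powers of [a] and [b] gives A >= - V X and B <= - V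
    Y, hence A - B + V Z >= V (Y + Z - X) >= 0. *)
Lemma subsolution_ineqB (R : realType) (p V A B u v a b : R) :
  2 <= p -> 0 <= V -> 0 < v -> v <= u -> 0 < b -> b <= a ->
  - (a `^ (p - 2) * A) - V * (u `^ (p - 2) * u) <= 0 ->
  0 <= - (b `^ (p - 2) * B) - V * (v `^ (p - 2) * v) ->
  - ((a - b) `^ (p - 2) * (A - B)) - V * ((u - v) `^ (p - 2) * (u - v)) <= 0.
Proof.
move=> p2 V0 v0 vu b0 ba hu hv.
have z0 : 0 <= u - v by rewrite subr_ge0.
(* For [p = 2] all powers are 1 and the two hypotheses are simply subtracted, even when [a = b]. *)
have [pE|p2'] := eqVneq p 2.
  by move: hu hv; rewrite pE subrr !powRr0; lra.
have [cE|ab] := eqVneq a b.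
  rewrite cE subrr powR0 ?subr_eq0// mul0r oppr0 sub0r oppr_le0.
  by rewrite !mulr_ge0 ?powR_ge0.
have {ab}ba : b < a by rewrite lt_neqAle eq_sym ab.
have := powR_quotient_subadditive p2 (ltW v0) vu b0 ba.
have Pa : 0 < a `^ (p - 2) by rewrite powR_gt0// (lt_trans b0).
have Pb : 0 < b `^ (p - 2) by rewrite powR_gt0.
have Pc : 0 < (a - b) `^ (p - 2) by rewrite powR_gt0// subr_gt0.
set X := u `^ _ * u / _; set Y := v `^ _ * v / _; set Z := _ / (a - b) `^ _.
have KX : u `^ (p - 2) * u = a `^ (p - 2) * X.
  by rewrite [RHS]mulrC divfK// gt_eqF.
have KY : v `^ (p - 2) * v = b `^ (p - 2) * Y.
  by rewrite [RHS]mulrC divfK// gt_eqF.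
have KZ : (u - v) `^ (p - 2) * (u - v) = (a - b) `^ (p - 2) * Z.
  by rewrite [RHS]mulrC divfK// gt_eqF.
move: hu hv; rewrite KX KY KZ => hu hv XYZ.
have hA : 0 <= A + V * X.
  by rewrite -(pmulr_rge0 _ Pa); lra.
have hB : 0 <= - (B + V * Y).
  by rewrite -(pmulr_rge0 _ Pb); lra.
have hC : 0 <= V * (Y + Z - X) by rewrite mulr_ge0// subr_ge0.
have : 0 <= (a - b) `^ (p - 2) * (A - B + V * Z).
  by apply: mulr_ge0; [exact: ltW | lra].
by lra.
Qed.

Lemma quadratic_operatorB (R : realType) (N : nat) (k : R) (n : 'I_N -> R)
    (A B C : 'I_N -> 'I_N -> R) :
    (forall i j, C i j = A i j - B i j) ->
  \sum_(i < N) (C i i + k * n i * \sum_(j < N) n j * C i j) =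
  \sum_(i < N) (A i i + k * n i * \sum_(j < N) n j * A i j) -
  \sum_(i < N) (B i i + k * n i * \sum_(j < N) n j * B i j).
Proof.
move=> CE; rewrite -sumrB; apply: eq_bigr => i _.
under eq_bigr do rewrite CE mulrBr.
by rewrite CE sumrB; ring.
Qed.

(** * Second-order calculus for differences of C^2 functions *)

Section SecondOrder.
Variables (R : realType) (N : nat) (Omega : set 'rV[R]_N).
Implicit Types (x : 'rV[R]_N) (f g u v : 'rV[R]_N -> R).

Lemma near_open (P : 'rV[R]_N -> Prop) x :
  open Omega -> Omega x -> (forall y, Omega y -> P y) -> \near x, P x.
Proof.
move=> oO Ox OP; have : nbhs x Omega by exact: open_nbhs_nbhs.
exact: filterS.
Qed.

Lemma continuous_eq_on f g x : open Omega -> Omega x ->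
  (forall y, Omega y -> f y = g y) -> {for x, continuous f} -> {for x, continuous g}.
Proof.
move=> oO Ox fg; rewrite /prop_for /continuous_at -fg//.
by apply: cvg_trans; exact: near_eq_cvg (near_open oO Ox fg).
Qed.

Lemma pderivB u v x i : C2_on Omega u -> C2_on Omega v -> Omega x ->
  pderiv i (u \- v) x = pderiv i u x - pderiv i v x.
Proof.
move=> Cu Cv Ox; have [_ du _] := Cu x Ox; have [_ dv _] := Cv x Ox.
by apply: deriveB; [case: (du i)|case: (dv i)].
Qed.

(** The formula for the first partial derivatives holds on all of the open set [Omega], hence near
    [x], and so can be differentiated again. *)
Lemma is_derive_pderivB u v x i j :
    open Omega -> C2_on Omega u -> C2_on Omega v -> Omega x ->
  is_derive x (ebase R j) (pderiv i (u \- v))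
    (pderiv j (pderiv i u) x - pderiv j (pderiv i v) x).
Proof.
move=> oO Cu Cv Ox.
apply: (@near_eq_is_derive _ _ _ (pderiv i u \- pderiv i v)).
  by apply: (near_open oO Ox) => y Oy; rewrite (pderivB _ Cu Cv Oy).
have [_ _ /(_ i j)[du _]] := Cu x Ox; have [_ _ /(_ i j)[dv _]] := Cv x Ox.
by apply: is_deriveB.
Qed.

Lemma C2_onB u v :
  open Omega -> C2_on Omega u -> C2_on Omega v -> C2_on Omega (u \- v).
Proof.
move=> oO Cu Cv x Ox.
have [cu du ddu] := Cu x Ox; have [cv dv ddv] := Cv x Ox.
split=> [|i|i j].
- exact: continuousB.
- split; first by apply: derivableB; [case: (du i)|case: (dv i)].
  apply: (continuous_eq_on (f := pderiv i u \- pderiv i v)) => //.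
    by move=> y Oy; rewrite (pderivB _ Cu Cv Oy).
  by apply: continuousB; [case: (du i)|case: (dv i)].
- split; first by case: (is_derive_pderivB i j oO Cu Cv Ox).
  apply: (continuous_eq_on
    (f := pderiv j (pderiv i u) \- pderiv j (pderiv i v))) => //.
    by move=> y Oy; have [_ /esym] := is_derive_pderivB i j oO Cu Cv Oy.
  by apply: continuousB; [case: (ddu i j)|case: (ddv i j)].
Qed.

Lemma radial_operatorB (p : R) u v x :
    open Omega -> C2_on Omega u -> C2_on Omega v -> Omega x ->
  radial_operator p (u \- v) x = radial_operator p u x - radial_operator p v x.
Proof.
move=> oO Cu Cv Ox; apply: quadratic_operatorB => i k.
by have [_] := is_derive_pderivB k i oO Cu Cv Ox; apply.
Qed.

End SecondOrder.

(** * Exclusion of the origin and conclusion *)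

Lemma enorm_gt0_rderiv (R : realType) (N : nat) (w : 'rV[R]_N -> R) x :
  rderiv w x != 0 -> 0 < enorm x.
Proof.
move=> h; rewrite lt_neqAle enorm_ge0 andbT eq_sym; apply: contraNneq h => x0.
(* As the inverse of 0 is 0, the direction x / |x| at the origin is the zero vector. *)
by rewrite /rderiv x0 invr0 scale0r derive0.
Qed.

Theorem theorem2p2 (R : realType) (N : nat) (p : R)
  (Omega : set 'rV[R]_N) (Vpot u v : 'rV[R]_N -> R) :
  (2 <= N)%N -> 2 <= p ->
  radial_domain Omega ->
  (forall x, Omega x -> {for x, continuous Vpot}) ->
  (forall x, Omega x -> 0 <= Vpot x) ->
  radial_on Omega u -> radial_on Omega v ->
  C2_on Omega u -> C2_on Omega v ->
  (forall x, Omega x -> 0 < v x /\ v x <= u x) ->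
  ((forall x, Omega x -> rderiv u x <= rderiv v x /\ rderiv v x < 0) \/
   (forall x, Omega x -> rderiv u x >= rderiv v x /\ rderiv v x > 0)) ->
  subsolution p Vpot Omega u -> supersolution p Vpot Omega v ->
  subsolution p Vpot Omega (u \- v).
Proof.
move=> _ p2 [oO _] _ V0 ru rv Cu Cv uv signs [_ subu] [_ supv].
split=> [|x Ox]; first exact: C2_onB.
have [vx0 vux] := uv x Ox.
(* Both sign alternatives give the same relations between absolute values, so the rest needs no case
   distinction. *)
have [b0 ba cE] : [/\ 0 < `|rderiv v x|, `|rderiv v x| <= `|rderiv u x| &
    `|rderiv u x - rderiv v x| = `|rderiv u x| - `|rderiv v x|].
  case: signs => /(_ x Ox)[uv' v0].
    have u0 := le_lt_trans uv' v0.
    rewrite (ltr0_norm v0) (ltr0_norm u0) ler0_norm; last by lra.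
    by split; lra.
  have u0 := lt_le_trans v0 uv'.
  rewrite (gtr0_norm v0) (gtr0_norm u0) ger0_norm; last by lra.
  by split; lra.
have x0 : 0 < enorm x by apply: (@enorm_gt0_rderiv _ _ v); rewrite -normr_gt0.
have [_ du ddu] := Cu x Ox; have [_ dv ddv] := Cv x Ox.
have gu := radial_grad oO Ox ru x0 (fun i => proj1 (du i)).
have gv := radial_grad oO Ox rv x0 (fun i => proj1 (dv i)).
(* The gradient of the difference is again a multiple of x / |x|; the coefficient may be 0, which
   [plap_radial] allows. *)
have gz j : pderiv j (u \- v) x = (rderiv u x - rderiv v x) * (x ord0 j / enorm x).
  by rewrite (pderivB _ Cu Cv Ox) gu gv mulrBl.
have ddz i j : derivable (pderiv j (u \- v)) x (ebase R i).
  by case: (is_derive_pderivB j i oO Cu Cv Ox).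
have [_ pu] := plap_radial p2 x0 gu (fun i j => proj1 (ddu j i)).
have [_ pv] := plap_radial p2 x0 gv (fun i j => proj1 (ddv j i)).
have [exz pz] := plap_radial p2 x0 gz ddz.
split=> //; have [_] := subu x Ox; have [_] := supv x Ox.
rewrite /Lop pu pv pz (radial_operatorB _ oO Cu Cv Ox) cE.
have ux0 : 0 < u x by exact: lt_le_trans vux.
have z0 : 0 <= (u \- v) x by rewrite subr_ge0.
rewrite (gtr0_norm vx0) (gtr0_norm ux0) (ger0_norm z0) => hv hu.
exact: subsolution_ineqB p2 (V0 x Ox) vx0 vux b0 ba hu hv.
Qed.
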